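(* Let $V$ be a ground set, $f\colon 2^V\to\mathbb{R}_{\ge 0}$ a normalized monotone submodular function, $k\ge 1$ an integer budget, $\epsilon\in(0,1)$, and consider an inhomogeneous-decaying data stream in which all lifespans are at most $L$. The algorithm BasicStreaming achieves a $(1/2-\epsilon)$ approximation guarantee: at every time $t$, its output $S_t$ is a subset of the set $\mathcal{S}_t$ of active elements with $|S_t|\le k$ and $$f(S_t)\ \ge\ \Big(\tfrac12-\epsilon\Big)\,\mathrm{OPT}_t .$$
   Context: **Stream model.** A data stream is a sequence of elements of a ground set $V$ arriving in chronological order; element $v$ arrives at discrete time $t_v\in\mathbb{N}$ (several elements may arrive at the same time). On arrival $v$ is given an initial lifespan $l(v,t_v)\in\mathbb{N}$, $l(v,t_v)\ge 1$; at time $t\ge t_v$ its remaining lifespan is $l(v,t)=l(v,t_v)-(t-t_v)$, and $v$ is discarded when this becomes $0$. The set of active elements at time $t$ is $\mathcal{S}_t=\{v\in V: t_v\le t,\ l(v,t)>0\}$. All initial lifespans are assumed to be at most $L$. **Problem.** $f\colon 2^V\to\mathbb{R}_{\ge0}$ is submodular ($f(S\cup\{s\})-f(S)\ge f(T\cup\{s\})-f(T)$ for $S\subseteq T\subseteq V$, $s\in V\setminus T$), monotone ($f(S)\le f(T)$ for $S\subseteq T$) and normalized ($f(\emptyset)=0$). Write $\delta(s|S)=f(S\cup\{s\})-f(S)$ and $\mathrm{OPT}_t=\max\{f(S): S\subseteq\mathcal{S}_t,\ |S|\le k\}$. **SieveStreaming (parameters $k,\epsilon$).** Processes elements one by one.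 It keeps $\Delta$, the largest singleton value $f(\{v\})$ seen so far (including the current element), and the set of thresholds $\Theta=\{(1+\epsilon)^i: i\in\mathbb{Z},\ \Delta/(2k)\le(1+\epsilon)^i\le\Delta\}$ (about $\log_{1+\epsilon}2k=O(\epsilon^{-1}\log k)$ of them), updated lazily as $\Delta$ grows; each threshold $\theta$ has a candidate set $C_\theta$, empty when $\theta$ first enters $\Theta$; thresholds leaving the range are deleted. For the current element $v$ and each $\theta\in\Theta$: if $|C_\theta|<k$ and $\delta(v|C_\theta)\ge\theta$, then $v$ is added to $C_\theta$. The output is a candidate set of maximum utility; feeding more elements never decreases the output value (the best candidate set encountered so far is retained). With no thresholds (e.g. $\Delta=0$) the output is $\emptyset$. **BasicStreaming.** Maintains $L$ SieveStreaming instances $\mathcal{A}_1^{(t)},\dots,\mathcal{A}_L^{(t)}$, all initially empty at $t=1$. At time $t$ let $V_l^{(t)}$ be the set of elements arriving at time $t$ with lifespan $l$. Data update: for each $l=1,\dots,L$, instance $\mathcal{A}_l^{(t)}$ is fed all elements of $\bigcup_{i\ge l}V_i^{(t)}$. Then the algorithm outputs $S_t$, the output of $\mathcal{A}_1^{(t)}$. Time update: $\mathcal{A}_{l-1}^{(t+1)}\gets\mathcal{A}_l^{(t)}$ for $l=2,\dots,L$; $\mathcal{A}_1^{(t)}$ is reset (thresholds and candidate sets emptied) and becomes $\mathcal{A}_L^{(t+1)}$. *)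

(* Defs.v *)
From mathcomp Require Import all_boot all_order all_algebra finmap.
From mathcomp Require Import all_classical all_reals.

Set Implicit Arguments.
Unset Strict Implicit.
Unset Printing Implicit Defensive.

Import Order.TTheory GRing.Theory Num.Theory.
Local Open Scope classical_set_scope.
Local Open Scope ring_scope.

Section SetFunctions.
Variables (R : realType) (V : choiceType).
Implicit Types (f : set V -> R) (s : V) (S T : set V).

Definition marginal f s S : R := f (S `|` [set s]) - f S.

Definition normalized f := f set0 = 0.

Definition monotone f := forall S T, S `<=` T -> f S <= f T.

Definition submodular f := forall S T s,
  S `<=` T -> ~ T s -> marginal f s T <= marginal f s S.

End SetFunctions.

(* Time starts at 1, when the algorithm is initialized.  [batch t] lists the
   finitely many elements arriving at time t in their order in the stream, so
   that the stream is batch 1 ++ batch 2 ++ ...  Not every v : V has to arrive;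
   [arrival v] (t_v) and [lifespan v] (l(v, t_v)) are meaningless if v does
   not. *)
Record data_stream (V : choiceType) := DataStream {
  arrival : V -> nat;
  lifespan : V -> nat;
  batch : nat -> seq V;
  batch_uniq : forall t, uniq (batch t);
  batch_arrival : forall t v, v \in batch t -> arrival v = t;
  batch_time : batch 0%N = [::];
  lifespan_gt0 : forall t v, v \in batch t -> (1 <= lifespan v)%N
}.

Section Problem.
Variables (R : realType) (V : choiceType).
Variables (f : set V -> R) (k : nat) (D : data_stream V).

(* l(v, t), with value 0 once v has been discarded *)
Definition remaining (v : V) (t : nat) : nat :=
  (lifespan D v - (t - arrival D v))%N.

Definition active (t : nat) : {fset V} :=
  [fset v in flatten [seq batch D s | s <- iota 0%N t.+1]
     | (0 < remaining v t)%N]%fset.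

(* The default value 0 of the maximum is f of the empty set, which is feasible. *)
Definition OPT (t : nat) : R :=
  \big[Num.max/0]_(S <- fpowerset (active t) | (#|` S| <= k)%N) f [set` S].

End Problem.

Section SieveStreaming.
Variables (R : realType) (V : choiceType).
Variables (f : set V -> R) (k : nat) (eps : R).

(* State of an instance: the largest singleton value Delta; the candidate sets,
   indexed by the exponent i of the threshold (1 + eps) ^ i and empty when that
   threshold is not in Theta; all the candidate sets held since the instance
   was last empty. *)
Record sieve := Sieve {
  delta_max : R;
  candidate : int -> {fset V};
  encountered : set {fset V}
}.

Definition sieve_empty : sieve :=
  Sieve 0 (fun=> fset0) [set fset0].

Definition threshold (i : int) : R := (1 + eps) ^ i.

Definition in_Theta (Delta : R) (i : int) : bool :=
  Delta / (2 * k%:R) <= threshold i <= Delta.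

Definition sieve_insert (v : V) (i : int) (C : {fset V}) : {fset V} :=
  if (#|` C| < k)%N && (threshold i <= marginal f v [set` C])
  then (v |` C)%fset else C.

Definition sieve_step (A : sieve) (v : V) : sieve :=
  let Delta := Num.max (delta_max A) (f [set v]) in
  let C i := if in_Theta Delta i then sieve_insert v i (candidate A i)
             else fset0 in
  Sieve Delta C (encountered A `|` [set C i | i in [set i | in_Theta Delta i]]).

Definition sieve_feed (A : sieve) (s : seq V) : sieve := foldl sieve_step A s.

(* Ties are broken arbitrarily, hence a relation.  The empty set belongs to
   [encountered A] from the start, and is the only output when no threshold
   has ever been present. *)
Definition sieve_output (A : sieve) (S : {fset V}) : Prop :=
  encountered A S /\ forall C, encountered A C -> f [set` C] <= f [set` S].

End SieveStreaming.

Section BasicStreaming.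
Variables (R : realType) (V : choiceType).
Variables (f : set V -> R) (k : nat) (eps : R) (L : nat) (D : data_stream V).

(* The instances A_1, ..., A_L; indices outside 1, ..., L are unused. *)
Definition instances := nat -> sieve R V.

Definition data_update (t : nat) (A : instances) : instances := fun l =>
  sieve_feed f k eps (A l) [seq v <- batch D t | (l <= lifespan D v)%N].

Definition time_update (A : instances) : instances := fun l =>
  if (l < L)%N then A l.+1 else sieve_empty R V.

(* A^(t), before the data update of time t *)
Fixpoint basic_state (t : nat) : instances :=
  if t is (s.+1 as u).+1 then time_update (data_update u (basic_state u))
  else fun=> sieve_empty R V.

Definition basic_output (t : nat) (S : {fset V}) : Prop :=
  sieve_output f (data_update t (basic_state t) 1%N) S.

End BasicStreaming.

(* Main.v *)
(* Before the data update of time t, the instance A_l has been fed exactly the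
   elements whose remaining lifespan at time t is at least l: a reset discards
   nothing relevant, since lifespans are at most L.  So after the update A_1 has
   been fed exactly the active elements, and the guarantee is that of
   SieveStreaming on them. *)

Require Import Defs.
From mathcomp Require Import all_boot all_order all_algebra finmap.
From mathcomp Require Import all_classical all_reals.
From mathcomp Require Import zify lra.

Set Implicit Arguments.
Unset Strict Implicit.
Unset Printing Implicit Defensive.

Import Order.TTheory GRing.Theory Num.Theory.
Local Open Scope classical_set_scope.
Local Open Scope ring_scope.

(** * Finite maxima and powers of [1 + eps] *)

Lemma seq_argmax (R : realType) (T : choiceType) (F : T -> R) (P : set T)
    (s : seq T) :
  P !=set0 -> (forall x, P x -> x \in s) ->
  exists x, P x /\ forall y, P y -> F y <= F x.
Proof.
move=> [x0 Px0] Ps.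
pose i0 : seq_sub s := SeqSub (Ps _ Px0).
case: (@arg_maxP _ _ _ i0 (fun i => `[< P (val i) >]) (fun i => F (val i))
  (asboolT Px0)) => i /asboolP Pi Fmax.
by exists (val i); split=> // y Py; exact: (Fmax (SeqSub (Ps _ Py)) (asboolT Py)).
Qed.

(** Bernoulli's inequality and the archimedean property. *)
Lemma exprn_unbounded (R : realType) (eps x : R) :
  0 < eps -> exists n, x <= (1 + eps) ^+ n.
Proof.
move=> e0.
have bern n : 1 + n%:R * eps <= (1 + eps) ^+ n.
  elim: n => [|n IH]; first by rewrite mul0r addr0.
  rewrite exprS -natr1; have := ler0n R n; nra.
exists (Num.bound `|x / eps|); apply: le_trans (bern _).
have := le_lt_trans (ler_norm _) (archi_boundP (normr_ge0 (x / eps))).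
rewrite ltr_pdivrMr //; lra.
Qed.

Lemma threshold_gt0 (R : realType) (eps : R) i : 0 < eps -> 0 < threshold eps i.
Proof. by move=> e0; apply: exprz_gt0; lra. Qed.

(** The exponent may be negative, so [x] is first scaled above 1 by a power [m]; the least natural
    exponent for the scaled number is then shifted back by [m]. *)
Lemma threshold_least (R : realType) (eps x : R) : 0 < eps -> 0 < x ->
  exists i, x <= threshold eps i <= (1 + eps) * x.
Proof.
move=> e0 x0; have b0 : 0 < 1 + eps by lra.
have [m xm] := exprn_unbounded (2 * x^-1) e0.
have bm0 : 0 < (1 + eps) ^+ m by exact: exprn_gt0.
have xbm : 1 < x * (1 + eps) ^+ m.
  have : x * (2 * x^-1) <= x * (1 + eps) ^+ m by rewrite ler_pM2l.
  rewrite mulrCA divff ?gt_eqF // mulr1; lra.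
pose P n := x * (1 + eps) ^+ m <= (1 + eps) ^+ n.
have exP : exists n, P n by exact: exprn_unbounded.
(* Exponent 0 fails because the scaled number exceeds 1, so the minimum has a predecessor, whose
   failure gives the upper bound. *)
case: (ex_minnP exP) => -[|n]; rewrite /P ?expr0 => Pn minn; first by lra.
have /negP : ~~ P n by apply/negP => /minn; rewrite ltnn.
move=> /negP; rewrite /P -ltNge => ltn.
have thE : threshold eps (n.+1%:Z - m%:Z) = (1 + eps) ^+ n.+1 / (1 + eps) ^+ m.
  by rewrite /threshold expfzDr ?gt_eqF // -exprnP exprnN.
exists (n.+1%:Z - m%:Z); rewrite thE ler_pdivlMr // ler_pdivrMr // Pn /=.
by rewrite exprS -mulrA ler_pM2l // ltW.
Qed.

(** * Marginals of submodular functions *)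

Section Submodular.
Variables (R : realType) (V : choiceType) (f : set V -> R).
Hypotheses (f_norm : normalized f) (f_mono : monotone f) (f_sub : submodular f).

Lemma marginal_mem (s : V) (S : set V) : S s -> marginal f s S = 0.
Proof.
move=> Ss; have sS : [set s] `<=` S by move=> _ ->.
by rewrite /marginal setUC (setUidr sS) subrr.
Qed.

Lemma marginal_le_singleton (s : V) (S : set V) : marginal f s S <= f [set s].
Proof.
have [Ss|nSs] := pselect (S s).
  by rewrite marginal_mem // -f_norm; exact: f_mono.
apply: le_trans (f_sub (sub0set S) nSs) _.
by rewrite /marginal set0U f_norm subr0.
Qed.

(** Adding [o] to [C] one element at a time, each gain is at most the marginal over [C] itself, by
    diminishing returns. *)
Lemma submodular_union_le (C : set V) (th : R) (o : seq V) : 0 <= th ->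
  (forall v, v \in o -> C v \/ marginal f v C <= th) ->
  f (C `|` [set` o]) <= f C + (size o)%:R * th.
Proof.
move=> th0; elim: o => [|v o IH] ho.
  by rewrite mul0r addr0; apply: f_mono => x [].
have {}IH := IH (fun u uo => ho u (@mem_behead _ (v :: o) u uo)).
have -> : C `|` [set` v :: o] = (C `|` [set` o]) `|` [set v].
  apply/seteqP; split=> x /=; rewrite inE.
    by case=> [|/orP[/eqP|]]; [left; left|right|left; right].
  by case=> [[|]|->]; [left|move=> ->; right; rewrite orbT|right; rewrite eqxx].
have : marginal f v (C `|` [set` o]) <= th.
  have [Cov|nCov] := pselect ((C `|` [set` o]) v); first by rewrite marginal_mem.
  have [|Cv|] := ho v; first exact: mem_head.
    by case: nCov; left.
  by apply: le_trans; apply: f_sub => //; left.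
rewrite /marginal /= -natr1; lra.
Qed.

End Submodular.

(** * Invariants and guarantee of a single sieve *)

Section Sieve.
Variables (R : realType) (V : choiceType) (f : set V -> R) (k : nat) (eps : R).
Hypotheses (f_ge0 : forall S, 0 <= f S) (f_norm : normalized f).
Hypotheses (f_mono : monotone f) (f_sub : submodular f).
Hypotheses (k_ge1 : (1 <= k)%N) (eps_gt0 : 0 < eps).

Let run (s : seq V) : sieve R V := sieve_feed f k eps (sieve_empty R V) s.

Lemma sieve_feed_rcons (A : sieve R V) s v :
  sieve_feed f k eps A (rcons s v) = sieve_step f k eps (sieve_feed f k eps A s) v.
Proof. by rewrite /sieve_feed -cats1 foldl_cat. Qed.

Lemma delta_max_ge (s : seq V) v : v \in s -> f [set v] <= delta_max (run s).
Proof.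
rewrite /run; elim/last_ind: s => [//|s u IH].
rewrite sieve_feed_rcons mem_rcons inE /= le_max => /orP[/eqP ->|/IH ->//].
by rewrite lexx orbT.
Qed.

Lemma delta_max_le (s : seq V) b : 0 <= b ->
  (forall v, v \in s -> f [set v] <= b) -> delta_max (run s) <= b.
Proof.
rewrite /run => b0; elim/last_ind: s => [//|s u IH] sb.
rewrite sieve_feed_rcons /= ge_max sb ?mem_rcons ?mem_head // andbT.
by apply: IH => v vs; apply: sb; rewrite mem_rcons inE vs orbT.
Qed.

Lemma sieve_insert_sub v i (C : {fset V}) :
  (sieve_insert f k eps v i C `<=` v |` C)%fset.
Proof. by rewrite /sieve_insert; case: ifP => _ //; exact: fsubsetU1. Qed.

Lemma card_sieve_insert v i (C : {fset V}) :
  (#|` C| <= k)%N -> (#|` sieve_insert f k eps v i C| <= k)%N.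
Proof.
rewrite /sieve_insert; case: ifP => // /andP[Ck _] _.
by rewrite cardfsU1; apply: leq_trans Ck; rewrite -add1n leq_add2r leq_b1.
Qed.

Lemma candidate_feasible (s : seq V) i (C := candidate (run s) i) :
  {subset C <= s} /\ (#|` C| <= k)%N.
Proof.
rewrite {}/C /run; elim/last_ind: s => [|s v [IHs IHk]].
  by split; rewrite ?cardfs0.
rewrite sieve_feed_rcons /=; case: ifP => _; last by split; rewrite ?cardfs0.
split; last exact: card_sieve_insert.
move=> x /(fsubsetP (sieve_insert_sub _ _ _)); rewrite mem_rcons !inE.
by case/orP=> [->//|/IHs ->]; rewrite orbT.
Qed.

Lemma encountered_feasible (s : seq V) C : encountered (run s) C ->
  {subset C <= s} /\ (#|` C| <= k)%N.
Proof.
rewrite /run; elim/last_ind: s => [|s v IH] /=.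
  by move=> ->; split; rewrite ?cardfs0.
rewrite sieve_feed_rcons => -[/IH[IHs IHk]|].
  by split=> // x /IHs xs; rewrite mem_rcons inE xs orbT.
move=> [i _ <-]; have := candidate_feasible (rcons s v) i.
by rewrite /run sieve_feed_rcons.
Qed.

Lemma encountered_fset0 (s : seq V) : encountered (run s) fset0.
Proof.
by rewrite /run; elim/last_ind: s => [//|s v IH]; rewrite sieve_feed_rcons; left.
Qed.

Lemma encountered_candidate (s : seq V) i :
  in_Theta k eps (delta_max (run s)) i ->
  encountered (run s) (candidate (run s) i).
Proof.
rewrite /run; case/lastP: s => [|s v]; first by [].
by rewrite sieve_feed_rcons => iT; right; exists i.
Qed.

(** Every insertion raises the value by at least the threshold and the cardinality by at most
    one. *)
Lemma candidate_value (s : seq V) i (C := candidate (run s) i) :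
  #|` C|%:R * threshold eps i <= f [set` C].
Proof.
rewrite {}/C /run; elim/last_ind: s => [|s v].
  by rewrite cardfs0 mul0r.
rewrite sieve_feed_rcons /=; move: (candidate _ _) => C IH.
case: ifP => _; last by rewrite cardfs0 mul0r f_ge0.
rewrite /sieve_insert; case: ifP => // /andP[_].
rewrite /marginal cardfsU1 set_fsetU1 setUC.
have := threshold_gt0 i eps_gt0; case: (v \in C) => /=; rewrite ?add0n; first by lra.
rewrite natrD; lra.
Qed.

(* Theta is updated lazily: an element that arrives before the threshold enters
   Theta has singleton value, hence marginal value, below the threshold. *)
Lemma candidate_saturated (s : seq V) i (C := candidate (run s) i) v :
  delta_max (run s) / (2 * k%:R) <= threshold eps i ->
  v \in s -> (#|` C| < k)%N -> v \in C \/ marginal f v [set` C] <= threshold eps i.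
Proof.
rewrite {}/C /run; elim/last_ind: s v => [//|s u IH] v.
move=> le_th; rewrite mem_rcons => vs.
have [] := boolP (in_Theta k eps (delta_max (run (rcons s u))) i); last first.
  rewrite /in_Theta le_th /= -ltNge => lt_th _; right.
  apply: le_trans (marginal_le_singleton f_norm f_mono f_sub _ _) _.
  by apply: le_trans (delta_max_ge _) (ltW lt_th); rewrite mem_rcons.
rewrite /run sieve_feed_rcons /=.
move: le_th; rewrite sieve_feed_rcons /= => le_th iT; rewrite iT.
have {IH} := fun le => IH ^~ (le_trans le le_th).
(* The largest singleton value never decreases, so the lower bound on the threshold held before [u]
   as well, as the induction hypothesis requires. *)
have dle : delta_max (run s) / (2 * k%:R)
    <= Num.max (delta_max (run s)) (f [set u]) / (2 * k%:R).
  by rewrite ler_pM2r ?le_max ?lexx // invr_gt0 mulr_gt0 // ltr0n.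
move=> /(_ dle).
move: (candidate _ _) => C IH.
rewrite /sieve_insert; case: ifPn => [/andP[Ck _] _|].
  move: vs; rewrite inE => /orP[/eqP ->|vs]; first by left; rewrite !inE eqxx.
  have [vC|] := IH v vs Ck; first by left; rewrite !inE vC orbT.
  have [vC|vC le] := boolP (v \in u |` C)%fset; first by left.
  right; apply: le_trans le; apply: f_sub; last exact/negP.
  by rewrite set_fsetU1; exact: subsetUr.
(* Since [C] is not full, [u] was rejected for its small marginal. *)
rewrite negb_and => /orP[/negP //|]; rewrite -ltNge => lt Ck.
by move: vs; rewrite inE => /orP[/eqP ->|vs]; [right; exact: ltW|exact: IH].
Qed.

Lemma sieve_output_exists (s : seq V) :
  exists S, sieve_output f (run s) S.
Proof.
pose X := fpowerset [fset v in s]%fset.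
apply: (@seq_argmax _ _ (fun C : {fset V} => f [set` C]) _ X).
  by exists fset0; exact: encountered_fset0.
move=> C /encountered_feasible[Cs _]; rewrite fpowersetE.
by apply/fsubsetP => x /Cs; rewrite !inE.
Qed.

(* The threshold used is the least power of 1 + eps above W / (2 k), W being
   f O: it is in Theta since Delta <= W <= k Delta.  If its candidate
   set is full, its value is at least k * threshold >= W / 2; otherwise all
   marginals are below the threshold and the candidate set misses at most
   k * threshold <= (1 + eps) W / 2. *)
Lemma sieve_output_approx (s : seq V) (O S : {fset V}) : eps < 1 ->
  {subset O <= s} -> (#|` O| <= k)%N ->
  (forall v, v \in s -> f [set v] <= f [set` O]) ->
  sieve_output f (run s) S -> (1 / 2 - eps) * f [set` O] <= f [set` S].
Proof.
move=> eps_lt1 Os Ok Omax [_ Smax].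
have k0 : 0 < k%:R :> R by rewrite ltr0n.
have OkR : #|` O|%:R <= k%:R :> R by rewrite ler_nat.
set W := f [set` O] in Omax *; have S0 := f_ge0 [set` S].
have [W0|W0] := leP W 0.
  by have -> : W = 0 by [apply/le_anti; rewrite W0 f_ge0]; rewrite mulr0.
set Delta := delta_max (run s).
have DW : Delta <= W by apply: delta_max_le => //; exact: f_ge0.
have D0 : 0 <= Delta.
  rewrite /Delta /run; elim/last_ind: (s) => [//|r u IH].
  by rewrite sieve_feed_rcons /= le_max IH.
have WD : W <= k%:R * Delta.
  have h v : v \in (O : seq V) -> set0 v \/ marginal f v set0 <= Delta.
    move=> /Os vs; right.
    exact: le_trans (marginal_le_singleton f_norm f_mono f_sub _ _) (delta_max_ge vs).
  have := submodular_union_le f_mono f_sub D0 h.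
  rewrite set0U f_norm add0r => /le_trans; apply.
  exact: ler_wpM2r.
pose x := W / (2 * k%:R).
have Wx : W = 2 * k%:R * x by rewrite mulrC divfK // gt_eqF // mulr_gt0.
have x0 : 0 < x by rewrite divr_gt0 // mulr_gt0.
have [i /andP[xi ix]] := threshold_least eps_gt0 x0.
have Di : Delta / (2 * k%:R) <= threshold eps i.
  by apply: le_trans xi; rewrite ler_pM2r // invr_gt0 mulr_gt0.
have iT : in_Theta k eps Delta i.
  rewrite /in_Theta Di /=.
  (* Here [eps < 1] matters: the threshold is at most [(1 + eps) * x < 2 * x]. *)
  have : 2 * x <= Delta by rewrite -(ler_pM2l k0); nra.
  by nra.
have := Smax _ (encountered_candidate iT).
have := candidate_value s i; have [_] := candidate_feasible s i.
have := @candidate_saturated s i _ Di; rewrite -/(run s).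
move: (candidate _ _) => C /= sat; rewrite leq_eqVlt => /orP[/eqP ->|Ck] val CS.
  apply: le_trans CS; apply: le_trans val; rewrite Wx.
  have : k%:R * x <= k%:R * threshold eps i by rewrite ler_pM2l.
  have : 0 < k%:R * x by rewrite mulr_gt0.
  by nra.
apply: le_trans CS.
have th0 := threshold_gt0 i eps_gt0.
have := submodular_union_le f_mono f_sub (ltW th0)
  (fun v vO => sat v (Os _ vO) Ck) (o := O).
have : W <= f ([set` C] `|` [set` (O : seq V)]).
  by apply: f_mono; exact: subsetUr.
have : #|` O|%:R * threshold eps i <= k%:R * ((1 + eps) * x).
  by apply: ler_pM => //; exact: ltW.
(* The bounds above give [(1 - eps) / 2 * W], which exceeds the claim by [eps * W / 2]. *)
have : 0 < eps * W by rewrite mulr_gt0.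
by rewrite Wx; lra.
Qed.

End Sieve.

(** * What each instance has been fed *)

Section Basic.
Variables (R : realType) (V : choiceType) (f : set V -> R).
Variables (k L : nat) (eps : R) (D : data_stream V).
Hypothesis le_L : forall t v, v \in batch D t -> (lifespan D v <= L)%N.

(* The elements of batch s whose remaining lifespan at time t >= s is at least l. *)
Definition long_lived t l (s : nat) : seq V :=
  [seq v <- batch D s | (l + (t - s) <= lifespan D v)%N].

Lemma long_lived0 t l : long_lived t l 0 = [::].
Proof. by rewrite /long_lived batch_time. Qed.

Lemma data_updateE t l (A : instances R V) :
  A l = sieve_feed f k eps (sieve_empty R V)
          (flatten [seq long_lived t l s | s <- iota 0 t]) ->
  data_update f k eps D t A l = sieve_feed f k eps (sieve_empty R V)
          (flatten [seq long_lived t l s | s <- iota 0 t.+1]).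
Proof.
rewrite /data_update => ->.
rewrite -(addn1 t) iotaD map_cat flatten_cat /sieve_feed foldl_cat /= cats0.
by rewrite /long_lived add0n subnn addn0.
Qed.

Lemma basic_stateE t l : basic_state f k eps L D t l =
  sieve_feed f k eps (sieve_empty R V)
    (flatten [seq long_lived t l s | s <- iota 0 t]).
Proof.
elim: t l => [//|[_ l|t IH l]]; first by rewrite /= long_lived0.
(* The time update lowers the index by one while every age grows by one, so [l + (t - s)] is
   preserved; [s <= t.+1] avoids truncated subtraction. *)
have shift s : s \in iota 0 t.+2 -> long_lived t.+2 l s = long_lived t.+1 l.+1 s.
  rewrite mem_iota => /andP[_ s_lt]; apply: eq_in_filter => v _.
  by congr (_ <= _)%N; lia.
change (time_update L (data_update f k eps D t.+1 (basic_state f k eps L D t.+1)) l =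
  sieve_feed f k eps (sieve_empty R V)
    (flatten [seq long_lived t.+2 l s | s <- iota 0 t.+2])).
rewrite (proj1 (eq_in_map _ _ _) shift) /time_update.
case: ifPn => [_|]; first exact: data_updateE.
rewrite -leqNgt => Ll.
(* A freshly reset instance is correct: its elements would need a lifespan above [L]. *)
suff -> : [seq long_lived t.+1 l.+1 s | s <- iota 0 t.+2] = [seq [::] | s <- iota 0 t.+2].
  by elim: (iota _ _).
apply/eq_in_map => s _; apply/eqP; rewrite -[_ == _]negbK -has_filter.
apply/hasPn => v /le_L; lia.
Qed.

End Basic.

Theorem theorem1 (R : realType) (V : choiceType) (f : set V -> R)
    (k L : nat) (eps : R) (D : data_stream V)
    (f_ge0 : forall S : set V, 0 <= f S)
    (f_norm : normalized f) (f_mono : monotone f) (f_sub : submodular f)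
    (k_ge1 : (1 <= k)%N) (eps_gt0 : 0 < eps) (eps_lt1 : eps < 1)
    (le_L : forall (t : nat) (v : V),
        v \in batch D t -> (lifespan D v <= L)%N)
    (t : nat) (t_ge1 : (1 <= t)%N) :
  (exists S : {fset V}, basic_output f k eps L D t S) /\
  (forall S : {fset V}, basic_output f k eps L D t S ->
     [/\ (S `<=` active D t)%fset,
         (#|` S| <= k)%N
       & (1 / 2 - eps) * OPT f k D t <= f [set` S]]).
Proof.
rewrite /basic_output (data_updateE (basic_stateE _ _ _ le_L t 1)).
set s := flatten _.
have activeE v : (v \in active D t) = (v \in s).
  rewrite /active !inE /remaining.
  rewrite -[LHS]/((v \in flatten [seq batch D r | r <- iota 0 t.+1]) && _).
  apply/andP/flattenP.
    move=> [/flattenP[_ /mapP[r rt ->] vr] alive].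
    exists (long_lived D t 1 r); first exact: map_f.
    by rewrite mem_filter vr andbT; move: alive; rewrite (batch_arrival vr); lia.
  move=> [_ /mapP[r rt ->]]; rewrite mem_filter => /andP[alive vr]; split.
    by apply/flattenP; exists (batch D r) => //; exact: map_f.
  by rewrite (batch_arrival vr); lia.
split; first exact: sieve_output_exists.
move=> S outS; have [Ss Sk] := encountered_feasible outS.1.
split=> //; first by apply/fsubsetP => v /Ss; rewrite activeE.
pose feasible := [set O : {fset V} | (O `<=` active D t)%fset /\ (#|` O| <= k)%N].
have [||O [[Oact Ok] Omax]] :=
  @seq_argmax _ _ (fun O : {fset V} => f [set` O]) feasible (fpowerset (active D t)).
- by exists fset0; split; rewrite ?fsub0set ?cardfs0.
- by move=> O [Oact _]; rewrite fpowersetE.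
have OPTE : OPT f k D t = f [set` O].
  apply/le_anti/andP; split.
    (* The default value 0 of the maximum is harmless, [f] being nonnegative. *)
    rewrite /OPT big_seq_cond; apply: bigmax_le => // C /andP[].
    by rewrite fpowersetE => Cact Ck; exact: Omax.
  by apply: le_bigmax_seq => //; rewrite fpowersetE.
rewrite OPTE; apply: (sieve_output_approx f_ge0 f_norm f_mono f_sub k_ge1 eps_gt0) outS => //.
  by move=> v /(fsubsetP Oact); rewrite activeE.
(* Active singletons are feasible because [1 <= k], so the optimum dominates them. *)
move=> v vs; rewrite -set_fset1; apply: Omax; split; last by rewrite cardfs1.
by rewrite fsub1set activeE.
Qed.
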